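(* Let $P$ be a finite poset and let $f\colon P\to\mathbb{R}$ be a discrete Morse function. Suppose that $P$ is 2-wide, is parity-graded with parity rank function $\mu$, and is downward Eulerian. Then for every sufficiently large $m\in\mathbb{N}$ and every unit vector $\xi\in S^{m-1}$, there is a polyhedral embedding $\phi\colon \Delta(P)\to\mathbb{R}^m$ such that projection of $\mathbb{R}^m$ onto the line spanned by $\xi$ is general for $\phi(\Delta(P))$, and such that for every $b\in P$, \[ i(\phi(b),\xi)=\begin{cases}(-1)^{\mu(b)}, & \text{if } b \text{ is discrete-critical with respect to } f,\\ 0, & \text{if } b \text{ is discrete-ordinary with respect to } f.\end{cases}\]
   Context: All posets are finite. For $a,b$ in a poset $P$, $a\prec b$ means $b$ covers $a$. The order complex $\Delta(P)$ is the simplicial complex with vertex set $P$ whose simplices are the nonempty chains of $P$. $P$ is 2-wide if whenever $a\prec b\prec c$ there is $d\neq b$ with $a\prec d\prec c$. A function $\mu\colon P\to\{0,1\}$ is a parity rank function if $\mu(a)=0$ for every minimal element $a$ and $\mu(b)=1-\mu(a)$ whenever $a\prec b$; $P$ is parity-graded if it has one. For $a\in P$ let $P_{<a}=\{x\in P: x<a\}$. $P$ (with parity rank function $\mu$) is downward Eulerian if for every non-minimal $a\in P$, $\chi(\Delta(P_{<a}))=(-1)^{\mu(a)+1}+1$. A function $f\colon P\to\mathbb{R}$ is a discrete Morse function if for each $b\in P$ there is at most one $a\prec b$ with $f(a)\ge f(b)$ and at most one $c$ with $b\prec c$ and $f(b)\ge f(c)$. An element $b$ is discrete-critical if there is no $a\prec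 b$ with $f(a)\ge f(b)$ and no $c\succ b$ with $f(b)\ge f(c)$; otherwise it is discrete-ordinary. A polyhedral embedding is an embedding affine-linear on each simplex. For a simplicial complex $K$ embedded polyhedrally in $\mathbb{R}^m$ and $\xi\in S^{m-1}$, projection onto the line spanned by $\xi$ is general for $K$ if $v\cdot\xi\ne w\cdot\xi$ for any two vertices $v,w$ joined by an edge; then Banchoff's index of a vertex $v$ is $i(v,\xi)=\sum_s(-1)^{\dim s}$, summed over all simplices $s$ of $K$ (including $\{v\}$) having $v$ as a vertex with $v\cdot\xi\ge w\cdot\xi$ for every vertex $w$ of $s$. *)

(* Defs.v *)
From HB Require Import structures.
From mathcomp Require Import all_boot all_order all_algebra.
From mathcomp Require Import all_classical all_reals all_analysis.
Import Order.TTheory GRing.Theory Num.Theory.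
Import numFieldNormedType.Exports.

Set Implicit Arguments.
Unset Strict Implicit.
Unset Printing Implicit Defensive.

Local Open Scope ring_scope.

Section Posets.
Context {d : Order.disp_t} {P : finPOrderType d}.

Definition covered_by (a b : P) : bool :=
  (a < b)%O && ~~ [exists c : P, (a < c)%O && (c < b)%O].

Definition minimal (a : P) : bool := ~~ [exists x : P, (x < a)%O].

Definition two_wide : Prop :=
  forall a b c : P, covered_by a b -> covered_by b c ->
    exists d : P, [/\ d != b, covered_by a d & covered_by d c].

(* The values 0 and 1 are encoded as [false] and [true], so that [1 - mu a]
   is [~~ mu a]; the coercion from [bool] to [nat] recovers the numbers. *)
Definition parity_rank_function (mu : P -> bool) : Prop :=
  (forall a : P, minimal a -> mu a = false) /\
  (forall a b : P, covered_by a b -> mu b = ~~ mu a).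

(* The order complex of the subposet [A] of [P]. *)
Definition order_complex (A : {set P}) : {set {set P}} :=
  [set s : {set P} | [&& s != finset.set0, s \subset A &
    [forall x in s, forall y in s, (x <= y)%O || (y <= x)%O]]].

Definition strictly_below (a : P) : {set P} := [set x : P | (x < a)%O].

End Posets.

Arguments two_wide {d} P.

(* A finite simplicial complex is given by the set of its nonempty simplices,
   a simplex being the set of its vertices. *)
Section Complexes.
Context {V : finType}.

Definition dim (s : {set V}) : nat := #|s|.-1.

Definition euler_characteristic (K : {set {set V}}) : int :=
  \sum_(s in K) (-1) ^+ dim s.

Context {R : realType}.

(* Points of the geometric realization are vectors of barycentric coordinates,
   indexed by the vertices through [enum_rank]. *)
Definition bary (x : 'rV[R]_#|V|) (v : V) : R := x ord0 (enum_rank v).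

Definition vertex (v : V) : 'rV[R]_#|V| := delta_mx ord0 (enum_rank v).

Definition closed_simplex (s : {set V}) : set 'rV[R]_#|V| :=
  [set x | [/\ forall v, 0 <= bary x v,
               forall v, v \notin s -> bary x v = 0
             & \sum_v bary x v = 1]]%classic.

Definition realization (K : {set {set V}}) : set 'rV[R]_#|V| :=
  [set x | exists2 s, s \in K & closed_simplex s x]%classic.

End Complexes.

Section TopologicalEmbedding.
Local Open Scope classical_set_scope.
Context {T U : topologicalType}.

Definition topological_embedding (A : set T) (g : T -> U) : Prop :=
  {within A, continuous g} /\
  exists2 h : U -> T, {within g @` A, continuous h} &
                      forall x, A x -> h (g x) = x.

End TopologicalEmbedding.

Section Embeddings.
Context {R : realType} {V : finType} {m : nat}.
Implicit Types (K : {set {set V}}) (phi : 'rV[R]_#|V| -> 'rV[R]_m).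

Definition affine_on_simplices K phi : Prop :=
  forall s, s \in K -> forall x y, closed_simplex s x -> closed_simplex s y ->
    forall t : R, 0 <= t <= 1 ->
      phi (t *: x + (1 - t) *: y) = t *: phi x + (1 - t) *: phi y.

(* Only the values of [phi] on the realization of [K] are relevant. *)
Definition polyhedral_embedding K phi : Prop :=
  topological_embedding (realization K) phi /\ affine_on_simplices K phi.

Definition dot (u v : 'rV[R]_m) : R := \sum_(i < m) u ord0 i * v ord0 i.

(* The library norm on row vectors is the sup norm, hence this definition. *)
Definition euclidean_norm (u : 'rV[R]_m) : R := Num.sqrt (dot u u).

(* In the next two definitions the embedded complex is the image of [K] under
   [phi], and its vertex [phi (vertex v)] is referred to by [v]. *)
Definition projection_general K phi (xi : 'rV[R]_m) : Prop :=
  forall v w : V, v != w -> [set v; w]%SET \in K ->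
    dot (phi (vertex v)) xi != dot (phi (vertex w)) xi.

Definition banchoff_index K phi (xi : 'rV[R]_m) (v : V) : int :=
  \sum_(s in K | (v \in s) &&
      [forall w in s, dot (phi (vertex w)) xi <= dot (phi (vertex v)) xi])
    (-1) ^+ dim s.

End Embeddings.

Definition downward_eulerian {d : Order.disp_t} {P : finPOrderType d}
    (mu : P -> bool) : Prop :=
  forall a : P, ~~ minimal a ->
    euler_characteristic (order_complex (strictly_below a))
      = (-1) ^+ (mu a).+1 + 1.

Section DiscreteMorse.
Context {R : realType} {d : Order.disp_t} {P : finPOrderType d}.

Definition exceptional_below (f : P -> R) (b : P) : {set P} :=
  [set a : P | covered_by a b && (f a >= f b)].

Definition exceptional_above (f : P -> R) (b : P) : {set P} :=
  [set c : P | covered_by b c && (f b >= f c)].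

Definition discrete_morse (f : P -> R) : Prop :=
  forall b : P, (#|exceptional_below f b| <= 1)%N /\
                (#|exceptional_above f b| <= 1)%N.

Definition discrete_critical (f : P -> R) (b : P) : bool :=
  (exceptional_below f b == finset.set0) && (exceptional_above f b == finset.set0).

Definition discrete_ordinary (f : P -> R) (b : P) : bool :=
  ~~ discrete_critical f b.

End DiscreteMorse.

(* Main.v *)
(* The index of a vertex v depends only on the heights h of the vertices: it is
   1 minus the Euler characteristic of the complex of chains in the lower link
   of v, the set of elements comparable to v and of smaller height. Any heights
   can be realized by an injective linear map as soon as m > |P|.
   The pairs a < b of covers with f b <= f a form a matching. Heights are chosen
   to be increasing along P except on matched pairs, where they are reversed.
   Such heights exist: collapsing every matched pair to its upper element, f
   itself is strictly increasing along the order between distinct blocks. Then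
   - if v is matched with c above it, the lower link of v is a cone with apex c;
   - if v is matched with a below it, the lower link is P_{<v} without a, and
     removing a cancels the Euler characteristic by downward Eulerianness,
     because the link of a in P_{<v} is P_{<a};
   - if v is critical, the lower link is P_{<v}. *)
Require Import Defs.
From HB Require Import structures.
From mathcomp Require Import all_boot all_order all_algebra.
From mathcomp Require Import all_classical all_reals all_analysis.
Import Order.TTheory GRing.Theory Num.Theory.
Import numFieldNormedType.Exports.

Local Open Scope ring_scope.

(** * Signed chain counts and Banchoff's index *)

Section ChainSums.
Context {d : Order.disp_t} {P : finPOrderType d}.
Implicit Types (v w : P) (s t A : {set P}).

Definition is_chain s : bool := [forall x in s, forall y in s, (x >=< y)%O].

(* The empty chain is included, so this is a reduced Euler characteristic with
   the opposite sign. *)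
Definition chain_sum A : int :=
  \sum_(s : {set P} | (s \subset A) && is_chain s) (-1) ^+ #|s|.

Definition link v A : {set P} := [set w in A | (w != v) && (v >=< w)%O].

Lemma is_chainP s :
  reflect {in s &, forall x y, (x >=< y)%O} (is_chain s).
Proof.
apply: (iffP forall_inP) => [H x y xs ys|H x xs]; first exact: (forall_inP (H x xs)).
by apply/forall_inP => y ys; apply: H.
Qed.

Lemma chain_sumE A : chain_sum A = 1 - euler_characteristic (order_complex A).
Proof.
rewrite /chain_sum (bigD1 finset.set0) /=; last first.
  by rewrite finset.sub0set; apply/is_chainP => x y; rewrite inE.
rewrite cards0 expr0; congr (_ + _); rewrite /euler_characteristic -sumrN.
apply: eq_big => [s|s /andP[_ s0]].
  by rewrite inE andbC.
by rewrite -[in LHS](@prednK #|s|) ?card_gt0 // exprS mulN1r.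
Qed.

(** Removing [v] is a bijection onto the chains of the link, with the chain consisting of [v] alone
    going to the empty one. *)
Lemma sum_chains_through v A : v \in A ->
  \sum_(s : {set P} | ((s \subset A) && is_chain s) && (v \in s))
     (-1) ^+ #|s|.-1 = chain_sum (link v A) :> int.
Proof.
move=> vA; rewrite (reindex_onto (fun t => v |: t)%SET (fun s => s :\ v)%SET) /=;
  last by move=> s /andP[_ vs]; rewrite finset.setD1K.
apply: eq_big => [t|t /andP[_ /eqP tE]]; last first.
  have vt : v \notin t by rewrite -tE !inE eqxx.
  by rewrite cardsU1 vt.
apply/idP/idP.
  move=> /andP[/andP[/andP[sA /is_chainP ch] _] /eqP tE].
  have vt : v \notin t by rewrite -tE !inE eqxx.
  apply/andP; split; last first.
    by apply/is_chainP => x y xt yt; apply: ch; rewrite !inE ?xt ?yt orbT.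
  apply/fintype.subsetP => w wt; rewrite inE.
  rewrite (fintype.subsetP sA) ?inE ?wt ?orbT //=.
  rewrite ch ?inE ?eqxx ?wt ?orbT // andbT.
  by apply: contraNneq vt => <-.
move=> /andP[/fintype.subsetP tL /is_chainP ch].
have vt : v \notin t by apply/negP => /tL; rewrite !inE eqxx andbF.
rewrite finset.setU1K // eqxx andbT finset.setU11 andbT; apply/andP; split.
  apply/fintype.subsetP => w; rewrite !inE => /orP[/eqP->//|/tL].
  by rewrite inE => /andP[].
apply/is_chainP => x y; rewrite !inE => /orP[/eqP->|xt] /orP[/eqP->|yt].
- exact: comparablexx.
- by have := tL _ yt; rewrite inE => /and3P[].
- by have := tL _ xt; rewrite inE comparable_sym => /and3P[].
- exact: ch.
Qed.

Lemma chain_sum_delete v A : v \in A ->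
  chain_sum A = chain_sum (A :\ v) - chain_sum (link v A).
Proof.
move=> vA; rewrite /chain_sum (bigID (fun s => v \in s)) /= addrC; congr (_ + _).
  by apply: eq_bigl => s; rewrite finset.subsetD1 -!andbA; congr (_ && _); rewrite andbC.
rewrite -/(chain_sum _) -sum_chains_through // -sumrN.
apply: eq_bigr => s /andP[_ vs]; rewrite -[in LHS](@prednK #|s|).
  by rewrite exprS mulN1r.
by rewrite card_gt0; apply/finset.set0Pn; exists v.
Qed.

(** For an apex, link and deletion coincide, so the two terms of [chain_sum_delete] cancel. *)
Lemma chain_sum_cone v A : v \in A -> {in A, forall w, (v >=< w)%O} ->
  chain_sum A = 0.
Proof.
move=> vA cone; rewrite (chain_sum_delete v) //.
rewrite (_ : link v A = A :\ v)%SET ?subrr //.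
apply/finset.setP => w; rewrite !inE andbC; case wA: (w \in A); rewrite ?andbF //.
by rewrite cone // andbT.
Qed.

(** The simplices counted are the chains through [v] inside its sublevel set, where
    [sum_chains_through] applies. *)
Lemma banchoff_index_chain_sum (R : realType) (m : nat)
    (phi : 'rV[R]_#|P| -> 'rV[R]_m) (xi : 'rV[R]_m) (h : P -> nat) v :
  (forall w, dot (phi (vertex w)) xi = (h w)%:R) ->
  banchoff_index (order_complex [set: P]%SET) phi xi v
    = chain_sum [set w | [&& w != v, (v >=< w)%O & (h w <= h v)%N]].
Proof.
move=> hE.
rewrite (_ : [set w | _]%SET = link v [set w | (h w <= h v)%N]); last first.
  by apply/finset.setP => w; rewrite !inE andbA andbC.
rewrite -sum_chains_through ?inE // /banchoff_index; apply: eq_bigl => s.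
rewrite inE finset.subsetT /= -/(is_chain s).
have [vs|] := boolP (v \in s); last by rewrite !andbF.
have -> : s != finset.set0 by apply/finset.set0Pn; exists v.
rewrite /= !andbT andbC; congr (_ && _); apply/forall_inP/fintype.subsetP.
  by move=> H w ws; rewrite inE; have := H w ws; rewrite !hE ler_nat.
by move=> H w ws; rewrite !hE ler_nat; have := H w ws; rewrite inE.
Qed.

End ChainSums.

(** * The matching of [f] and the heights built from it *)

Section MorseHeight.
Context {R : realType} {d : Order.disp_t} {P : finPOrderType d}.
Context (f : P -> R) (hf : discrete_morse f) (hwide : two_wide P).
Implicit Types (a b c x y : P).

Definition matched a b : bool := Defs.covered_by a b && (f b <= f a).

Definition match_top a : P := odflt a [pick c | matched a c].

Definition matched_up a : bool := [exists c, matched a c].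

(* Matched pairs become blocks at the level of their upper element, and within
   a block the two elements are swapped. *)
Definition height a : nat :=
  (#|[set x | (f (match_top x) < f (match_top a))%R]%SET|.*2 + matched_up a)%N.

Lemma covered_by_lt a b : Defs.covered_by a b -> (a < b)%O.
Proof. by case/andP. Qed.

Lemma lt_cover a b : (a < b)%O -> exists2 y, (a <= y)%O & Defs.covered_by y b.
Proof.
move=> ab.
have a0 : ((a <= a) && (a < b))%O by rewrite lexx ab.
(* Maximizing the number of elements strictly below yields a maximal [y] with [a <= y < b]. *)
case: (@arg_maxnP _ a (fun y => (a <= y) && (y < b))%O
  (fun y => #|strictly_below y|) a0) => y /andP[ay yb] ymax.
exists y => //; rewrite /Defs.covered_by yb; apply/existsPn => c.
apply/negP => /andP[yc cb].
have := ymax c; rewrite cb (ltW (le_lt_trans ay yc)) => /(_ isT).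
rewrite /= leqNgt => /negP; apply; apply: proper_card; apply/properP; split.
  by apply/fintype.subsetP => z; rewrite !inE => /lt_trans; apply.
by exists y; rewrite inE ?ltxx.
Qed.

Lemma matched_top_unique a b c : matched a b -> matched a c -> b = c.
Proof.
move=> ab ac; have [_ /card_le1_eqP H] := hf a.
by apply: H; rewrite inE.
Qed.

Lemma matched_bottom_unique a b c : matched b a -> matched c a -> b = c.
Proof.
move=> ab ac; have [/card_le1_eqP H _] := hf a.
by apply: H; rewrite inE.
Qed.

Lemma unmatched_lt a b : Defs.covered_by a b -> ~~ matched a b -> f a < f b.
Proof. by rewrite /matched => -> /=; rewrite -ltNge. Qed.

(** The second element [e] between [a] and [c] given by 2-wideness is matched with neither, since
    both are already matched with [b]; hence [f a < f e < f c <= f b <= f a]. *)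
Lemma matched_not_chain a b c : matched a b -> ~~ matched b c.
Proof.
move=> mab; apply/negP => mbc.
have [cab fab] := andP mab; have [cbc fbc] := andP mbc.
have [e [neb cae cec]] := hwide _ _ _ cab cbc.
have h1 : f a < f e.
  apply: unmatched_lt => //; apply: contra neb => mae.
  by rewrite (matched_top_unique _ _ _ mae mab).
have h2 : f e < f c.
  apply: unmatched_lt => //; apply: contra neb => mec.
  by rewrite (matched_bottom_unique _ _ _ mec mbc).
have := lt_le_trans (lt_trans h1 h2) (le_trans fbc fab).
by rewrite ltxx.
Qed.

(* [f a < f b] can fail for [a < b] even if [b] does not cover [a], but a
   saturated chain from [a] to [b] can be rerouted, from the top down, around its matched
   covers by 2-wideness; only a match of [a] itself may obstruct this. *)
Lemma lt_of_no_match_below a b :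
  (a < b)%O -> (forall c, matched a c -> ~~ (c <= b)%O) -> f a < f b.
Proof.
have [n] := ubnP #|strictly_below b|; elim: n b => // n IHn b.
rewrite ltnS => bn ab na.
have IH y : (a < y)%O -> (y < b)%O -> f a < f y.
  move=> ay yb; apply: IHn => // [|c /na].
    apply: leq_trans bn; apply: proper_card; apply/properP; split.
      by apply/fintype.subsetP => z; rewrite !inE => /lt_trans; apply.
    by exists y; rewrite inE ?ltxx.
  by apply: contra => /le_trans; apply; exact: ltW.
have [y ay cyb] := lt_cover _ _ ab.
have yb := covered_by_lt _ _ cyb.
have [myb|nyb] := boolP (matched y b); last first.
  apply: le_lt_trans (unmatched_lt _ _ cyb nyb).
  by move: ay; rewrite le_eqVlt => /orP[/eqP->//|ay]; exact/ltW/IH.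
have ay' : (a < y)%O.
  rewrite lt_neqAle ay andbT; apply/eqP => ayE; subst y.
  by have := na _ myb; rewrite lexx.
have [w aw cwy] := lt_cover _ _ ay'.
have [e [ney cwe ceb]] := hwide _ _ _ cwy cyb.
apply: lt_trans (unmatched_lt e b ceb _); first apply: IH.
- exact: le_lt_trans aw (covered_by_lt _ _ cwe).
- exact: covered_by_lt.
- by apply: contra ney => meb; rewrite (matched_bottom_unique _ _ _ meb myb).
Qed.

Lemma top_matched a b : matched a b -> match_top a = b.
Proof.
move=> mab; rewrite /match_top; case: pickP => [c mac|/(_ b)]; last by rewrite mab.
exact: (matched_top_unique a).
Qed.

Lemma matched_upP a : reflect (matched a (match_top a)) (matched_up a).
Proof.
apply: (iffP existsP) => [[c mac]|H]; last by exists (match_top a).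
by rewrite (top_matched _ _ mac).
Qed.

Lemma top_id a : ~~ matched_up a -> match_top a = a.
Proof.
move=> nu; rewrite /match_top; case: pickP => // c mac.
by case/existsP: nu; exists c.
Qed.

Lemma top_not_matched a c : ~~ matched (match_top a) c.
Proof.
have [/matched_upP|/[dup] /top_id -> nu] := boolP (matched_up a).
  exact: matched_not_chain.
by apply: contra nu => mac; apply/existsP; exists c.
Qed.

Lemma le_top a : (a <= match_top a)%O.
Proof.
have [/matched_upP/andP[/covered_by_lt/ltW]|/top_id->] // := boolP (matched_up a).
Qed.

Lemma f_top_le a : f (match_top a) <= f a.
Proof.
have [/matched_upP/andP[]|/top_id->] // := boolP (matched_up a).
Qed.

(** If [match_top x <= match_top y], then [lt_of_no_match_below] applies from [match_top x], which
    has no match above; otherwise it applies from [x], whose only possible match above is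
    [match_top x]. *)
Lemma lt_f_top x y : (x < y)%O -> match_top x != match_top y -> f (match_top x) < f (match_top y).
Proof.
move=> xy nxy; have xty := lt_le_trans xy (le_top y).
have [le|nle] := boolP (match_top x <= match_top y)%O.
  apply: lt_of_no_match_below; first by rewrite lt_neqAle nxy.
  by move=> c mc; have := top_not_matched x c; rewrite mc.
apply: le_lt_trans (f_top_le x) _; apply: lt_of_no_match_below => // c mxc.
by rewrite -(top_matched _ _ mxc).
Qed.

(** Were [x] its own top, then [x < y <= match_top y = x]; were both matched upward, they would be
    equal by uniqueness of the lower partner. *)
Lemma top_eq_matched x y : (x < y)%O -> match_top x = match_top y -> matched x y.
Proof.
move=> xy txy.
have [ux|/top_id tx] := boolP (matched_up x); last first.
  by have := lt_le_trans xy (le_top y); rewrite -txy tx ltxx.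
have mx := matched_upP _ ux.
have [uy|/top_id ty] := boolP (matched_up y); last by rewrite -ty -txy.
have := matched_upP _ uy; rewrite -txy => my.
by move: xy; rewrite (matched_bottom_unique _ _ _ mx my) ltxx.
Qed.

Lemma height_unmatched x y : (x < y)%O -> ~~ matched x y -> (height x < height y)%N.
Proof.
move=> xy nm.
have fxy : f (match_top x) < f (match_top y).
  by apply: lt_f_top => //; apply: contra nm => /eqP; exact: top_eq_matched.
rewrite /height; set c1 := #|_|; set c2 := #|_|.
have c12 : (c1 < c2)%N.
  apply: proper_card; apply/properP; split.
    by apply/fintype.subsetP => z; rewrite !inE => /lt_trans; apply.
  by exists x; rewrite inE ?ltxx.
(* Levels are doubled, so a strictly larger count outweighs the bit [matched_up x]. *)
apply: leq_trans (leq_addr _ _).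
rewrite -leq_double doubleS in c12; apply: leq_trans c12.
by rewrite -addn1 -[X in (_ <= X)%N]addn2 -addnA leq_add2l addn1 ltnS; case: matched_up.
Qed.

Lemma height_matched x y : matched x y -> (height y < height x)%N.
Proof.
move=> mxy; have ux : matched_up x by apply/existsP; exists y.
have uy : ~~ matched_up y.
  by apply/existsP => -[c myc]; have := matched_not_chain _ _ c mxy; rewrite myc.
by rewrite /height ux (negbTE uy) (top_matched _ _ mxy) (top_id y uy) addn0 addn1.
Qed.

Lemma height_neq x y : x != y -> (x >=< y)%O -> height x != height y.
Proof.
have lt_neq a b : (a < b)%O -> height a != height b.
  move=> ab; rewrite neq_ltn.
  have [/height_matched->|/(height_unmatched _ _ ab)->//] := boolP (matched a b).
  by rewrite orbT.
move=> nxy /comparable_ltgtP cmp.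
case: cmp nxy => [/lt_neq //|/lt_neq yx _|->] //.
by rewrite eq_sym.
Qed.

(** * Lower links and their chain sums *)

Definition lower_link v : {set P} :=
  [set w | [&& w != v, (v >=< w)%O & (height w <= height v)%N]]%SET.

(** By [height_unmatched], the only element above [v] in its lower link is its match; elements below
    [v] lie below that match too. *)
Lemma chain_sum_lower_link_up v : matched_up v -> chain_sum (lower_link v) = 0.
Proof.
move=> /matched_upP; set c := match_top v => mvc.
have vc := covered_by_lt _ _ (andP mvc).1.
apply: (chain_sum_cone c).
  by rewrite inE (gt_eqF vc) /Order.comparable (ltW vc) ltnW // height_matched.
move=> w; rewrite inE => /and3P[wv cmp].
case/comparable_ltgtP: cmp wv => [vw _ hw|wv _ _|->] //.
  have [mvw|/(height_unmatched _ _ vw)] := boolP (matched v w).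
    by rewrite (matched_top_unique _ _ _ mvw mvc) comparablexx.
  by rewrite ltnNge hw.
by rewrite /Order.comparable (ltW (lt_trans wv vc)) orbT.
Qed.

Lemma lower_link_not_up v : ~~ matched_up v ->
  lower_link v = [set w in strictly_below v | ~~ matched w v]%SET.
Proof.
move=> nv; apply/finset.setP => w; rewrite !inE; apply/and3P/andP.
  case=> wv /comparable_ltgtP cmp; case: cmp wv => [vw _|wv _ hw|->] //.
    rewrite leqNgt height_unmatched //.
    by apply: contra nv => mvw; apply/existsP; exists w.
  by split=> //; apply/negP => /height_matched; rewrite ltnNge hw.
case=> wv nm; split; first by rewrite lt_eqF.
  by rewrite /Order.comparable (ltW wv) orbT.
exact/ltnW/height_unmatched.
Qed.

Context (mu : P -> bool) (hmu : parity_rank_function mu)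
  (heul : downward_eulerian mu).

Lemma chain_sum_strictly_below v : chain_sum (strictly_below v) = (-1) ^+ mu v.
Proof.
rewrite chain_sumE; have [mv|nmv] := boolP (minimal v); last first.
  (* The [1] of the empty chain cancels the [+ 1] of the Eulerian condition. *)
  by rewrite heul // opprD addrCA subrr addr0 exprS mulN1r opprK.
rewrite hmu.1 // /euler_characteristic big1 ?subr0 // => s.
rewrite inE => /and3P[/finset.set0Pn[x xs] /fintype.subsetP/(_ x xs)].
by rewrite inE => xv; case/existsPn/(_ x)/negP: mv.
Qed.

Lemma chain_sum_lower_link_down a v : matched a v -> chain_sum (lower_link v) = 0.
Proof.
move=> mav; have [cav _] := andP mav; have av := covered_by_lt _ _ cav.
have nv : ~~ matched_up v.
  by apply/existsP => -[c mvc]; have := matched_not_chain _ _ c mav; rewrite mvc.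
have -> : lower_link v = (strictly_below v :\ a)%SET.
  rewrite lower_link_not_up //; apply/finset.setP => w; rewrite !inE andbC.
  congr (_ && _); congr (~~ _); apply/idP/eqP => [mwv|-> //].
  exact: matched_bottom_unique mwv mav.
have := chain_sum_delete a (strictly_below v); rewrite inE => /(_ av).
(* Nothing lies strictly between [a] and [v], so the link contains only elements below [a]. *)
have -> : link a (strictly_below v) = strictly_below a.
  apply/finset.setP => w; rewrite !inE; apply/and3P/idP => [[wv nwa cmp]|wa].
    case/comparable_ltgtP: cmp nwa => [aw _|//|//].
    by case/andP: cav => _ /existsPn/(_ w)/negP; rewrite aw wv.
  by rewrite (lt_trans wa av) (lt_eqF wa) /Order.comparable (ltW wa) orbT.
(* The deletion formula gives the sum of the signs of [v] and [a], which are opposite. *)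
rewrite !chain_sum_strictly_below (hmu.2 a v cav) => /eqP.
by rewrite eq_sym subr_eq => /eqP->; case: (mu a).
Qed.

Lemma discrete_criticalE v :
  discrete_critical f v = ~~ matched_up v && [forall a, ~~ matched a v].
Proof.
rewrite /discrete_critical andbC; congr (_ && _).
  apply/eqP/existsPn => [E c|H].
    by apply/negP => mvc; suff: c \in exceptional_above f v; [rewrite E inE|rewrite inE].
  by apply/finset.setP => c; rewrite !inE; exact/negbTE/H.
apply/eqP/forallP => [E c|H].
  by apply/negP => mvc; suff: c \in exceptional_below f v; [rewrite E inE|rewrite inE].
by apply/finset.setP => c; rewrite !inE; exact/negbTE/H.
Qed.

Lemma chain_sum_lower_link v :
  chain_sum (lower_link v) = if discrete_critical f v then (-1) ^+ mu v else 0.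
Proof.
rewrite discrete_criticalE.
have [/chain_sum_lower_link_up->//|nv] := boolP (matched_up v).
have [/forallP nm|/forallPn[a]] /= := boolP [forall a, ~~ matched a v].
  rewrite lower_link_not_up // -chain_sum_strictly_below; congr chain_sum.
  by apply/finset.setP => w; rewrite !inE nm andbT.
by rewrite negbK => /chain_sum_lower_link_down.
Qed.

End MorseHeight.

(** * Linear realization of prescribed heights *)

Lemma mulmxr_continuous (R : realType) (n m : nat) (A : 'M[R]_(n, m)) :
  continuous (fun x : 'rV[R]_n => x *m A).
Proof.
move=> x U [Q Qnbhs QU].
have coord i j : \forall y \near x, Q i j ((y *m A) i j).
  have cont : continuous (fun y : 'rV[R]_n => (y *m A) i j).
    under eq_fun do rewrite mxE.
    apply: continuous_big => [|k _]; first exact: add_continuous.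
    by move=> y; apply: continuousM; [exact: coord_continuous|exact: cst_continuous].
  exact/cont/Qnbhs.
have all_coord : \forall y \near x, forall i j, Q i j ((y *m A) i j).
  by do 2 (apply: (@filter_forall _ _ _ (nbhs x)) => ?); exact: coord.
by apply: filterS all_coord => y Hy; exact: QU.
Qed.

(** The hyperplane orthogonal to [xi] has room for [n] independent rows [D], as [n <= m - 1]; adding
    [h *m xi] then sets the heights. *)
Lemma injective_map_with_heights (R : realType) (n m : nat) (xi : 'rV[R]_m)
    (h : 'cV[R]_n) :
  (n < m)%N -> xi *m xi^T = 1%:M ->
  exists A : 'M[R]_(n, m), A *m xi^T = h /\ exists B : 'M[R]_(m, n), A *m B = 1%:M.
Proof.
move=> nm xi1.
have rk : (n <= \rank (kermx xi^T))%N.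
  rewrite mxrank_ker; apply: leq_trans (leq_sub2l m (rank_leq_col _)).
  by rewrite leq_subRL ?add1n // (leq_ltn_trans _ nm).
pose D : 'M[R]_(n, m) := rowsub (widen_ord rk) (row_base (kermx xi^T)).
have Dxi : D *m xi^T = 0.
  have /sub_kermxP H : (row_base (kermx xi^T) <= kermx xi^T)%MS by rewrite eq_row_base.
  by rewrite /D mul_rowsub_mx H; apply/matrixP => i j; rewrite !mxE.
have [B0 DB0] : exists B0 : 'M[R]_(m, n), D *m B0 = 1%:M.
  have /row_freeP[B BE] := row_base_free (kermx xi^T).
  exists (B *m (rowsub (widen_ord rk) 1%:M)^T).
  rewrite mulmxA /D mul_rowsub_mx BE; apply/matrixP => i j; rewrite !mxE.
  rewrite (bigD1 (widen_ord rk i)) //= !mxE eqxx mul1r big1 ?addr0.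
    by rewrite eq_sym -!val_eqE.
  by move=> k ki; rewrite !mxE eq_sym (negbTE ki) mul0r.
exists (h *m xi + D); split; first by rewrite mulmxDl -mulmxA xi1 mulmx1 Dxi addr0.
(* Projecting off [xi] before applying [B0] kills [h *m xi] and leaves [D] unchanged. *)
exists (B0 - xi^T *m (xi *m B0)).
have xiB : xi *m (B0 - xi^T *m (xi *m B0)) = 0.
  by rewrite mulmxBr (mulmxA xi) xi1 mul1mx subrr.
by rewrite mulmxDl -mulmxA xiB mulmx0 add0r mulmxBr (mulmxA D) Dxi mul0mx subr0.
Qed.

Lemma mulmx_polyhedral_embedding (R : realType) (V : finType) (m : nat)
    (K : {set {set V}}) (A : 'M[R]_(#|V|, m)) (B : 'M[R]_(m, #|V|)) :
  A *m B = 1%:M -> polyhedral_embedding K (fun x : 'rV[R]_#|V| => x *m A).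
Proof.
move=> AB; split; last by move=> s _ x y _ _ t _; rewrite mulmxDl -!scalemxAl.
split; first exact/continuous_subspaceT/mulmxr_continuous.
exists (fun y => y *m B); first exact/continuous_subspaceT/mulmxr_continuous.
by move=> x _; rewrite -mulmxA AB mulmx1.
Qed.

Theorem theorem1p5 (R : realType) (d : Order.disp_t) (P : finPOrderType d)
    (f : P -> R) (mu : P -> bool)
    (hf : discrete_morse f) (hwide : two_wide P)
    (hmu : parity_rank_function mu) (heul : downward_eulerian mu) :
  exists M : nat, forall m : nat, (M <= m)%N ->
    forall xi : 'rV[R]_m, euclidean_norm xi = 1 ->
      exists phi : 'rV[R]_#|P| -> 'rV[R]_m,
        [/\ polyhedral_embedding (order_complex [set: P]%SET) phi,
            projection_general (order_complex [set: P]%SET) phi xi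
          & forall b : P,
              (discrete_critical f b ->
                 banchoff_index (order_complex [set: P]%SET) phi xi b
                   = (-1) ^+ mu b) /\
              (discrete_ordinary f b ->
                 banchoff_index (order_complex [set: P]%SET) phi xi b = 0)].
Proof.
(* One dimension along [xi], and [#|P|] orthogonal to it. *)
exists #|P|.+1 => m Mm xi xi1.
have dotE (u v : 'rV[R]_m) : dot u v = (u *m v^T) ord0 ord0.
  by rewrite mxE; apply: eq_bigr => i _; rewrite mxE.
have xixi : xi *m xi^T = 1%:M.
  apply/matrixP => i j; rewrite !ord1 -dotE mxE eqxx.
  have dot0 : 0 <= dot xi xi by apply: sumr_ge0 => i0 _; rewrite -expr2 sqr_ge0.
  by rewrite -(sqr_sqrtr dot0) -[Num.sqrt _]/(euclidean_norm xi) xi1 expr1n.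
have [A [Axi [B AB]]] := injective_map_with_heights R #|P| m xi
  (\col_i (height f (enum_val i))%:R) Mm xixi.
exists (fun x => x *m A).
have heightE w : dot (vertex w *m A) xi = (height f w)%:R.
  by rewrite dotE -mulmxA Axi -rowE !mxE enum_rankK.
split; first exact: mulmx_polyhedral_embedding AB.
  move=> v w vw; rewrite inE => /and3P[_ _ /is_chainP ch].
  rewrite !heightE eqr_nat; apply: height_neq => //.
  by apply: ch; rewrite !inE eqxx ?orbT.
move=> b; rewrite (banchoff_index_chain_sum _ _ _ _ _ _ heightE).
rewrite -/(lower_link f b) (chain_sum_lower_link _ hf hwide _ hmu heul).
by split=> [->//|/negbTE->].
Qed.
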